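(* Let $r\ge 3$ and $q\ge 2$ be integers and, for $1\le i\le r$, let $$n_i=\left\lceil (r-1)\ln(2q\ln q)\,(4\ln q)^{r-i}\,q^{r+1-i}\right\rceil .$$ Then $\mathrm{HG}(\vec{C}_{n_1,\ldots,n_r})\ge q$. Consequently, for every fixed $r\ge3$, as $n\to\infty$, $$\mathrm{HG}(\vec{C}_{n,\ldots,n})=\Omega\left(n^{\frac1r-o(1)}\right),$$ where $\vec{C}_{n,\ldots,n}$ is the complete $r$-partite directed cycle with all $r$ parts of size $n$.
   Context: Let $G$ be a finite directed graph with vertices $v_1,\ldots,v_n$ and let $[q]=\{1,\ldots,q\}$ be a set of $q$ colors. A coloring is any $x\in[q]^n$, where $x_i$ is the color of $v_i$. A directed edge $v_i\to v_j$ means that $v_i$ sees the color of $v_j$. A guessing strategy is a choice, for each $i$, of a function $f_i$ with values in $[q]$ depending only on the colors of the outneighbors of $v_i$; vertex $v_i$ guesses correctly on $x$ if $f_i(x)=x_i$. $G$ is $q$-solvable if there is a guessing strategy such that for every $x\in[q]^n$ at least one vertex guesses correctly. $\mathrm{HG}(G)$ is the largest positive integer $q$ such that $G$ is $q$-solvable. For positive integers $n_1,\ldots,n_r$, the complete $r$-partite directed cycle $\vec{C}_{n_1,\ldots,n_r}$ is the directed graph whose vertex set is a disjoint union $V_1\cup\cdots\cup V_r$ with $|V_i|=n_i$, and whose directed edges are exactly $u\to w$ with $u\in V_i$, $w\in V_{i+1}$, $1\le i\le r$, where $V_{r+1}:=V_1$. *)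

(* Defs.v *)
From HB Require Import structures.
From mathcomp Require Import all_boot all_order all_algebra.
From mathcomp Require Import all_classical all_reals all_analysis.
Set Implicit Arguments.
Unset Strict Implicit.
Unset Printing Implicit Defensive.
Import Order.TTheory GRing.Theory Num.Theory.
Import numFieldNormedType.Exports.

(* A finite directed graph is a relation [e : rel V] on a finite type:
   [e v w] means v -> w, i.e., v sees the color of w. *)

Definition coloring (V : finType) (q : nat) := {ffun V -> 'I_q}.

(* [f v x] is the guess of v on x; it may depend only on the colors of the
   outneighbors of v. *)
Definition guessing_strategy (V : finType) (e : rel V) (q : nat)
    (f : V -> coloring V q -> 'I_q) : Prop :=
  forall (v : V) (x y : coloring V q),
    (forall w, e v w -> x w = y w) -> f v x = f v y.

Definition solvable (V : finType) (e : rel V) (q : nat) : Prop :=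
  exists2 f : V -> coloring V q -> 'I_q,
    guessing_strategy e f & forall x, exists v, f v x = x v.

Definition is_HG (V : finType) (e : rel V) (q : nat) : Prop :=
  [/\ 0 < q, solvable e q & forall p, solvable e p -> p <= q]%N.

(* The default value 0 is taken only when there is no largest q: when V is
   empty, or when e has a loop (a vertex then sees its own color). *)
Definition HG (V : finType) (e : rel V) : nat := xget 0%N [set q | is_HG e q]%classic.

Definition mcycle_vertex (r : nat) (n : 'I_r -> nat) : finType :=
  {i : 'I_r & 'I_(n i)}.

(* [ordS] is the cyclic successor i |-> i + 1 mod r. *)
Definition mcycle (r : nat) (n : 'I_r -> nat) : rel (mcycle_vertex n) :=
  fun u w => tag w == ordS (tag u).
Arguments mcycle {r} n.

Local Open Scope ring_scope.

(* For q >= 2 and r >= 2 the argument of the ceiling is positive, so the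
   absolute value only casts the integer ceiling to nat. *)
Definition part_size (R : realType) (r q i : nat) : nat :=
  `| Num.ceil ((r%:R - 1) * ln (2 * q%:R * ln q%:R)
               * (4 * ln q%:R) ^+ (r - i) * q%:R ^+ (r + 1 - i) : R) |%N.

(* Main.v *)
Require Import Defs.
From mathcomp Require Import all_boot all_order all_algebra.
From mathcomp Require Import all_classical all_reals all_analysis.
From mathcomp Require Import ring lra.
Import Order.TTheory GRing.Theory Num.Theory.
Import numFieldNormedType.Exports.
Set Implicit Arguments.
Unset Strict Implicit.

(** Write [L = q ln q], and let [x_1, ..., x_r] be the colorings of the parts. The
    part [V_i] sees [x_(i+1)] and announces a vector of guesses [G_i x_(i+1)]; it
    loses when this vector differs from [x_i] in every coordinate.

    For [i < r] the function [G_i] is chosen so that each [x_i] makes [V_i] lose for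
    fewer than [2 L] of the colorings [x_(i+1)]. Such a function exists because a
    random one works: [V_i] is about [4 L] times larger than [V_(i+1)], so a union
    bound over the coloring [x_i] and over the sets of [d + 1 >= 2 L] colorings
    [x_(i+1)] succeeds ([exists_rarely_avoided], [rare_inequality]).

    Fix [x_1]. Following the cycle from [V_1] to [V_r], each step multiplies the
    number of colorings compatible with a loss of all the parts so far by less than
    [2 L], so fewer than [(2 L) ^ (r - 1)] colorings [x_r] remain
    ([card_losing_ends]). The part [V_r] sees [x_1], hence knows this set. As
    [n_r >= (r - 1) q ln (2 L)], a random vector of guesses misses a given coloring of
    [V_r] everywhere with probability at most [(2 L) ^ - (r - 1)], so some vector
    agrees somewhere with every coloring of the set ([exists_hitting],
    [few_inequality]), and [V_r] wins whenever the other parts all lose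
    ([mcycle_solvable]).

    A graph without loops is [q]-solvable only for [q] at most its number of
    vertices ([solvable_leq_card]), so [HG] is a genuine maximum and solvability
    bounds it from below ([leq_HG]).

    For the asymptotic statement, solvability passes to larger parts, and the largest
    part [n_1] is at most a constant times [(q ln n) ^ r] when [q <= n]. Taking [q]
    to be the integer part of [n ^ (1 / r) / (ln n) ^ 2] makes it at most [n] for
    large [n], and [(ln n) ^ 2 = n ^ eps] with [eps = 2 ln ln n / ln n]
    ([HG_balanced_ge]). *)

(** * Counting vectors of guesses *)

Lemma leq_card_bigcup (I T : finType) (P : pred I) (A : I -> {set T}) :
  #|\bigcup_(i | P i) A i| <= \sum_(i | P i) #|A i|.
Proof.
elim/big_ind2: _ => [|m B n C leB leC|//]; first by rewrite cards0.
exact: leq_trans (leq_card_setU _ _) (leq_add leB leC).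
Qed.

Lemma union_bound (I T : finType) (P : pred I) (A : I -> {set T}) :
  \sum_(i | P i) #|A i| < #|T| -> exists t, forall i, P i -> t \notin A i.
Proof.
move=> ltT.
have /subsetPn[t _ tA] : ~~ ([set: T] \subset \bigcup_(i | P i) A i).
  apply/negP => /subset_leq_card; rewrite cardsT leqNgt => /negP; apply.
  exact: leq_ltn_trans (leq_card_bigcup _ _) ltT.
by exists t => i Pi; apply: contra tA => tAi; apply/bigcupP; exists i.
Qed.

(** When [y] is the vector of guesses of a part and [z] its coloring, [avoids y z]
    says that every vertex of that part guesses wrong. *)
Definition avoids {I C : finType} (y z : {ffun I -> C}) :=
  [forall i, y i != z i].

Lemma card_family_prod (T C : finType) (F : T -> pred C) :
  #|(family F : pred {ffun T -> C})| = \prod_t #|F t|.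
Proof. by rewrite card_family foldrE big_map -big_enum. Qed.

Lemma card_avoids (I C : finType) (z : {ffun I -> C}) :
  #|[set y | avoids y z]| = #|C|.-1 ^ #|I|.
Proof.
transitivity #|(family (fun i => predC1 (z i)) : pred {ffun I -> C})|.
  by rewrite cardsE; apply: eq_card => y; apply/forallP/forallP.
rewrite card_family_prod -prod_nat_const.
by apply: eq_bigr => i _; rewrite cardC1.
Qed.

(** A uniformly random [z] avoids a given [y] with probability
    [((c - 1) / c) ^ #|I|], where [c] is the number of colors, so for a small
    [B] the union bound leaves a [z] that avoids no element of [B]. *)
Lemma exists_hitting (I C : finType) (B : {set {ffun I -> C}}) :
  #|B| * #|C|.-1 ^ #|I| < #|C| ^ #|I| ->
  exists z, forall y, y \in B -> ~~ avoids z y.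
Proof.
move=> ltB; have [|z zB] :=
  @union_bound _ _ (mem B) (fun y => [set z | avoids z y]).
  rewrite (eq_bigr _ (fun y _ => card_avoids y)) sum_nat_const card_ffun.
  exact: ltB.
by exists z => y /zB; rewrite inE.
Qed.

Lemma ffact_leq_exp (n k : nat) : n ^_ k <= n ^ k.
Proof.
by elim: k => // k IHk; rewrite ffactnSr expnSr leq_mul // leq_subr.
Qed.

Lemma bin_leq_exp (n k : nat) : 'C(n, k) <= n ^ k.
Proof.
apply: leq_trans (ffact_leq_exp n k).
by rewrite -bin_ffact leq_pmulr // fact_gt0.
Qed.

Lemma exists_subset_card (T : finType) (A : {set T}) (k : nat) :
  k <= #|A| -> exists2 S : {set T}, S \subset A & #|S| = k.
Proof.
rewrite -bin_gt0 -cards_draws card_gt0 => /set0Pn[S].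
by rewrite inE => /andP[SA /eqP kS]; exists S.
Qed.

Lemma card_avoiding_on (I C M : finType) (S : {set M}) (x : {ffun I -> C}) :
  #|[set G : {ffun M -> {ffun I -> C}} | [forall m in S, avoids (G m) x]]|
  = (#|C|.-1 ^ #|I|) ^ #|S| * (#|C| ^ #|I|) ^ (#|M| - #|S|).
Proof.
pose F m : pred {ffun I -> C} :=
  fun y => (m \in S) ==> avoids y x.
transitivity #|(family F : pred {ffun M -> {ffun I -> C}})|.
  by rewrite cardsE; apply: eq_card => G; apply/forallP/forallP.
rewrite card_family_prod (bigID (mem S)) /=; congr (_ * _).
  rewrite -prod_nat_const; apply: eq_bigr => m mS.
  by rewrite -(card_avoids x) cardsE; apply: eq_card => y; rewrite /in_mem/= /F mS.
have -> : #|M| - #|S| = #|~: S| by rewrite [RHS]cardsCs finset.setCK.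
rewrite -card_ffun -prod_nat_const.
rewrite [RHS](eq_bigl (fun m => m \notin S)); last by move=> m; rewrite !inE.
by apply: eq_bigr => m mS; apply: eq_card => y; rewrite /in_mem/= /F (negPf mS).
Qed.

(** First-moment argument over all functions [G]. If the conclusion fails for [G],
    then some [x] and some [k]-subset [S] of [M] satisfy [avoids (G m) x] for all
    [m] in [S]. There are at most [#|M| ^ k * #|C| ^ #|I|] such pairs, and each
    is realized by a proportion [((#|C| - 1) / #|C|) ^ (#|I| * k)] of the
    functions, so under the hypothesis the bad functions do not exhaust all. *)
Lemma exists_rarely_avoided (I C M : finType) (k : nat) :
  0 < #|C| ->
  #|M| ^ k * #|C| ^ #|I| * #|C|.-1 ^ (#|I| * k) < #|C| ^ (#|I| * k) ->
  exists G : {ffun M -> {ffun I -> C}},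
    forall x, #|[set m | avoids (G m) x]| < k.
Proof.
move=> C_gt0 ltk; have [ltMk|lekM] := ltnP #|M| k.
  have /card_gt0P[c _] := C_gt0; exists [ffun=> [ffun=> c]] => x.
  exact: leq_ltn_trans (max_card _) ltMk.
pose A (p : {set M} * {ffun I -> C}) :=
  [set G : {ffun M -> {ffun I -> C}} | [forall m in p.1, avoids (G m) p.2]].
have [|G GA] := @union_bound _ _ (fun p : {set M} * {ffun I -> C} => #|p.1| == k) A.
  rewrite (eq_bigr (fun=> #|C|.-1 ^ (#|I| * k) * #|C| ^ (#|I| * (#|M| - k))));
    last first.
    by move=> [S x] /= /eqP kS; rewrite card_avoiding_on kS !expnM.
  rewrite sum_nat_const.
  have -> : #|[pred p : {set M} * {ffun I -> C} | #|p.1| == k]|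
          = 'C(#|M|, k) * #|C| ^ #|I|.
    rewrite -card_draws -card_ffun -cardsT -cardsX -[LHS]cardsE.
    by apply: eq_card => -[S x]; rewrite !inE andbT.
  rewrite !card_ffun -expnM -[X in _ < _ ^ (_ * X)](subnKC lekM) mulnDr expnD.
  rewrite !mulnA ltn_mul2r.
  rewrite expn_gt0 C_gt0 /=.
  by apply: leq_ltn_trans ltk; rewrite !leq_mul2r bin_leq_exp !orbT.
exists G => x; rewrite ltnNge; apply/negP => /exists_subset_card[S SA kS].
have := GA (S, x); rewrite /= kS eqxx => /(_ isT); rewrite inE => /negP; apply.
by apply/'forall_implyP => m /(fintype.subsetP SA); rewrite inE.
Qed.

(** * Solvability and the hat guessing number *)

(** Each vertex is right on exactly one coloring in [q]: recoloring [v] alone does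
    not change what [v] sees, since there are no loops. As every coloring has a
    vertex that is right on it, the number of vertices is at least [q]. This bound
    is what makes [HG] an attained maximum. *)
Lemma solvable_leq_card (V : finType) (e : rel V) (q : nat) :
  irreflexive e -> solvable e q -> q <= #|V|.
Proof.
move=> e0 [f fe f_wins]; have [->//|q_gt0] := posnP q.
pose A v := [set x : coloring V q | f v x == x v].
have leA v : #|A v| * q <= q ^ #|V|.
  (* (x, c) |-> x recolored by c at v is injective on (A v) x [q]. *)
  pose upd (p : coloring V q * 'I_q) : coloring V q :=
    [ffun w => if w == v then p.2 else p.1 w].
  have fupd p : f v (upd p) = f v p.1.
    apply: fe => w vw; rewrite ffunE; case: eqP vw => // ->; by rewrite e0.
  have: {in finset.setX (A v) [set: 'I_q] &, injective upd}.
    move=> p p'; rewrite !inE !andbT => /eqP Ap /eqP Ap' eq_upd.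
    have eqv : p.1 v = p'.1 v by rewrite -Ap -Ap' -!fupd eq_upd.
    rewrite [p]surjective_pairing [p']surjective_pairing; congr (_, _).
      apply/ffunP => w; have [->//|wv] := eqVneq w v.
      by have := congr1 (fun x : coloring V q => x w) eq_upd; rewrite !ffunE (negPf wv).
    by have := congr1 (fun x : coloring V q => x v) eq_upd; rewrite !ffunE eqxx.
  move=> /card_in_imset; rewrite cardsX cardsT card_ord => <-.
  by rewrite -[X in X ^ _](card_ord q) -card_ffun max_card.
rewrite leqNgt; apply/negP => ltVq.
have [|x xA] := @union_bound _ _ predT A.
  rewrite card_ffun card_ord -(ltn_pmul2r q_gt0) big_distrl /=.
  apply: (@leq_ltn_trans (#|V| * q ^ #|V|)); last first.
    by rewrite mulnC ltn_pmul2l // expn_gt0 q_gt0.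
  by rewrite -sum_nat_const leq_sum.
have [v fvx] := f_wins x; have := xA v isT.
by rewrite inE fvx eqxx.
Qed.

Lemma solvable1 (V : finType) (e : rel V) : 0 < #|V| -> solvable e 1.
Proof.
move=> /card_gt0P[v _]; exists (fun _ _ => ord0) => // x.
by exists v; rewrite [x v]ord1.
Qed.

Lemma leq_HG (V : finType) (e : rel V) (q : nat) :
  irreflexive e -> 0 < q -> solvable e q -> q <= HG e.
Proof.
move=> e0 q_gt0 sq; rewrite /HG.
suff [m m_HG]: exists m, is_HG e m.
  by have [] : is_HG e (xget 0 [set q | is_HG e q]%classic);
    [apply: (xgetPex 0); exists m | move=> _ _; exact].
have ex : exists q, `[< solvable e q >] by exists q; apply/asboolP.
have le p : `[< solvable e p >] -> p <= #|V|.
  by move=> /asboolP; exact: solvable_leq_card.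
case: (ex_maxnP ex le) => m /asboolP sm maxm; exists m; split=> //.
  by apply: leq_trans q_gt0 _; apply/maxm/asboolP.
by move=> p sp; apply/maxm/asboolP.
Qed.

(** The vertices in the image of [h] play the strategy of the smaller graph and the
    others guess color 0, which is why at least one color is required. *)
Lemma solvable_embedding (V W : finType) (e : rel V) (e' : rel W)
    (h : V -> W) (q : nat) :
  injective h -> (forall u v, e u v -> e' (h u) (h v)) ->
  solvable e q.+1 -> solvable e' q.+1.
Proof.
move=> h_inj he [f fe f_wins].
pose pull (x : coloring W q.+1) : coloring V q.+1 := [ffun v => x (h v)].
exists (fun w x => if [pick v | h v == w] is Some v then f v (pull x) else ord0).
  move=> w x y xy; case: pickP => // v /eqP hv; apply: fe => u vu.
  by rewrite !ffunE; apply: xy; rewrite -hv; exact: he.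
move=> x; have [v fv] := f_wins (pull x); exists (h v).
case: pickP => [u /eqP/h_inj->|/(_ v)]; last by rewrite eqxx.
by rewrite fv ffunE.
Qed.

Lemma mcycle_irreflexive (r : nat) (n : 'I_r -> nat) :
  1 < r -> irreflexive (mcycle n).
Proof.
case: r n => [|r] n // r_gt1 [i j]; apply/negbTE; rewrite /mcycle /= -val_eqE /=.
have := ltn_ord i; rewrite ltnS leq_eqVlt => /predU1P[->|ir].
  by rewrite modnn -lt0n.
by rewrite modn_small // ltn_eqF.
Qed.

(** The part [i] of the smaller cycle embeds as the first [m i] vertices of the
    part [i] of the larger one. *)
Lemma mcycle_solvable_mono (r q : nat) (m n : 'I_r -> nat) :
  (forall i, m i <= n i) ->
  solvable (mcycle m) q.+1 -> solvable (mcycle n) q.+1.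
Proof.
move=> mn; pose h (u : mcycle_vertex m) : mcycle_vertex n :=
  Tagged (fun i => 'I_(n i)) (widen_ord (mn (tag u)) (tagged u)).
apply: (@solvable_embedding _ _ _ _ h) => // -[i j] [i' j'] eqh.
have /= eqi := congr1 tag eqh; case: _ / eqi in j' eqh *.
move/eqP: eqh; rewrite eq_Tagged => /eqP/(congr1 val)/= eqj.
by congr Tagged; apply: val_inj.
Qed.

(** * The strategy on a multipartite cycle *)

Lemma dependent_choice (I : Type) (T : I -> Type) (Q : forall i, T i -> Prop) :
  (forall i, exists t, Q i t) -> exists t : forall i, T i, forall i, Q i (t i).
Proof.
by move=> exQ; exists (fun i => projT1 (cid (exQ i))) => i; exact: projT2 (cid _).
Qed.

Section Cycle.
Variables (r q : nat) (n : 'I_r.+1 -> nat).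

Let P i := {ffun 'I_(n i) -> 'I_q}.
Let state := {i : 'I_r.+1 & P i}.

Definition part_coloring (x : coloring (mcycle_vertex n) q) (i : 'I_r.+1) : P i :=
  [ffun j => x (Tagged (fun i => 'I_(n i)) j)].

(** A state is a part together with a coloring of it. The next states are the
    colorings of the following part under which the current part, playing [G],
    guesses wrong everywhere. Working in the sum over all parts avoids any transport
    along equalities between indices of parts. *)
Definition losing_next (G : forall i, P (ordS i) -> P i) (u : state) :
    {set state} :=
  [set Tagged P y | y in [set y | avoids (G (tag u) y) (tagged u)]].

Definition losing_ends (G : forall i, P (ordS i) -> P i) (m : nat) (u : state) :
    {set state} :=
  iter m (fun A : {set state} => \bigcup_(w in A) losing_next G w) [set u].

(** Starting from a coloring of part 0, each of the first [r] steps multiplies the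
    number of reachable states by at most [d]; the last part is reached by these
    steps but never left. *)
Lemma card_losing_ends (G : forall i, P (ordS i) -> P i) (d m : nat) (u : state) :
    (forall i, i != ord_max -> forall x, #|[set y | avoids (G i y) x]| <= d) ->
    tag u = ord0 -> m <= r ->
  #|losing_ends G m u| <= d ^ m /\
  forall w : state, w \in losing_ends G m u -> tag w = m :> nat.
Proof.
move=> Gd u0; elim: m => [_|m IHm ltmr].
  by split; [rewrite cards1 | move=> w; rewrite inE => /eqP->; rewrite u0].
have [lem tagm] := IHm (ltnW ltmr); split=> /=.
  apply: leq_trans (leq_card_bigcup _ _) _; rewrite expnSr.
  apply: (@leq_trans (#|losing_ends G m u| * d)); last by rewrite leq_mul2r lem orbT.
  rewrite -sum_nat_const; apply: leq_sum => w wm.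
  apply: leq_trans (leq_imset_card _ _) (Gd _ _ _).
  by apply: contraTneq ltmr => wmax; rewrite -(tagm w wm) wmax ltnn.
move=> w /bigcupP[v vm /imsetP[y _ ->]] /=.
by rewrite (tagm v vm) modn_small.
Qed.

(** If all parts but the last lose on [x], the colorings of the successive parts
    form a chain of losing steps. *)
Lemma losing_ends_part (G : forall i, P (ordS i) -> P i)
    (x : coloring (mcycle_vertex n) q) (m : nat) :
    (forall i, i != ord_max ->
       avoids (G i (part_coloring x (ordS i))) (part_coloring x i)) ->
    m <= r ->
  Tagged P (part_coloring x (inord m))
    \in losing_ends G m (Tagged P (part_coloring x ord0)).
Proof.
move=> lose; elim: m => [_|m IHm ltmr].
  have -> : inord 0 = ord0 :> 'I_r.+1 by apply: val_inj; rewrite /= inordK.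
  exact: set11.
apply/bigcupP; exists (Tagged P (part_coloring x (inord m))).
  exact: IHm (ltnW ltmr).
have -> : inord m.+1 = ordS (inord m) :> 'I_r.+1.
  by apply: val_inj; rewrite /= !inordK ?modn_small // ltnW.
apply/imset_f; rewrite inE; apply: lose.
by rewrite -val_eqE /= inordK ?ltn_eqF // ltnW.
Qed.

(** The combinatorial core. The parts before the last play rarely avoided guesses;
    then a coloring of part 0 leaves at most [d ^ r] colorings of the last part
    under which they all lose. The last part sees part 0, and guesses a
    vector that agrees somewhere with each of these colorings. *)
Lemma mcycle_solvable (d : nat) :
    0 < q ->
    (forall i, i != ord_max ->
       (q ^ n (ordS i)) ^ d.+1 * q ^ n i * q.-1 ^ (n i * d.+1) < q ^ (n i * d.+1)) ->
    d ^ r * q.-1 ^ n ord_max < q ^ n ord_max ->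
  solvable (mcycle n) q.
Proof.
move=> q_gt0 rare few.
have rareG i : exists Gi : P (ordS i) -> P i,
    i != ord_max -> forall x, #|[set y | avoids (Gi y) x]| <= d.
  have [->|/rare ltd] := eqVneq i ord_max.
    by exists (fun=> [ffun=> Ordinal q_gt0]).
  have [||G Gd] := @exists_rarely_avoided 'I_(n i) 'I_q (P (ordS i)) d.+1.
  - by rewrite card_ord.
  - have cP : #|P (ordS i)| = q ^ n (ordS i) by rewrite card_ffun !card_ord.
    by rewrite cP !card_ord.
  - by exists G.
have [G Gd] := dependent_choice rareG.
have ordS_max : ordS ord_max = ord0 :> 'I_r.+1.
  by apply: val_inj; rewrite /= modnn.
(* One family H of guesses for all the parts: G before the last part, and a
   hitting vector computed from the losing chains of G on the last part. *)
have hitH i : exists Hi : P (ordS i) -> P i, if i == ord_max then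
    forall t y, Tagged P y \in losing_ends G r (Tagged P t) -> ~~ avoids (Hi t) y
    else Hi = G i.
  have [->|_] := eqVneq i ord_max; last by exists (G i).
  have hit t : exists z : P ord_max, forall y : P ord_max,
      Tagged P y \in losing_ends G r (Tagged P (t : P (ordS ord_max))) ->
      ~~ avoids z y.
    pose B := [set y : P ord_max | Tagged P y \in losing_ends G r (Tagged P t)].
    have [] := @exists_hitting _ _ B; last first.
      by move=> z zB; exists z => y yB; apply: zB; rewrite inE.
    rewrite !card_ord; apply: leq_ltn_trans few; rewrite leq_mul2r; apply/orP; right.
    have [le_ends _] := card_losing_ends (u := Tagged P t) Gd ordS_max (leqnn r).
    apply: leq_trans le_ends; rewrite -(@card_imset _ _ (Tagged P (i := ord_max))).
      by apply/subset_leq_card/fintype.subsetP => _ /imsetP[y yB ->]; rewrite inE in yB.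
    by move=> y z /eqP; rewrite eq_Tagged => /eqP.
  by have [z zP] := dependent_choice hit; exists z.
have [H HE] := dependent_choice hitH.
exists (fun v x => H (tag v) (part_coloring x (ordS (tag v))) (tagged v)).
  move=> [i j] x y /= eqxy; congr (H i _ j); apply/ffunP => k; rewrite !ffunE.
  by apply: eqxy; rewrite /mcycle /= eqxx.
move=> x; apply: contrapT => lose.
have loses i : avoids (H i (part_coloring x (ordS i))) (part_coloring x i).
  apply/forallP => j; apply/eqP => win; apply: lose.
  exists (Tagged (fun i => 'I_(n i)) j).
  by rewrite /= win ffunE.
have := HE ord_max; rewrite eqxx => /(_ _ (part_coloring x ord_max)) hit.
have /hit/negP[] : Tagged P (part_coloring x ord_max) \in
    losing_ends G r (Tagged P (part_coloring x (ordS ord_max))); last exact: loses.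
have := @losing_ends_part G x r _ (leqnn r).
have -> : inord r = ord_max :> 'I_r.+1 by apply: val_inj; rewrite /= inordK.
rewrite ordS_max; apply=> i imax; have := loses i.
by have := HE i; rewrite (negPf imax) => ->.
Qed.
End Cycle.

(** * Part sizes *)

Local Open Scope ring_scope.

Lemma expR_ln_nat (R : realType) (q n : nat) :
  (0 < q)%N -> (q ^ n)%:R = expR (n%:R * ln q%:R) :> R.
Proof. by move=> q0; rewrite expRM_natl lnK ?posrE ?ltr0n // natrX. Qed.

Lemma pred_exp_le (R : realType) (q n : nat) :
  (0 < q)%N -> (q.-1 ^ n)%:R <= (q ^ n)%:R * expR (- (n%:R / q%:R)) :> R.
Proof.
move=> q0; have qR : 0 < q%:R :> R by rewrite ltr0n.
have key : q.-1%:R <= q%:R * expR (- q%:R^-1) :> R.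
  rewrite -ler_pdivrMl //; apply: le_trans (expR_ge1Dx _).
  by rewrite -subn1 natrB // mulrBr mulVf ?gt_eqF // mulr1.
rewrite -mulrN expRM_natl !natrX -exprMn.
by rewrite lerXn2r ?nnegrE ?mulr_ge0 ?expR_ge0.
Qed.

Lemma half_le_ln2 (R : realType) : 2^-1 <= ln 2 :> R.
Proof.
have := @le_ln1Dx R (- 2^-1); rewrite (_ : 1 - 2^-1 = 2^-1); last by lra.
by rewrite lnV ?posrE // => /(_ _); lra.
Qed.

Lemma half_le_ln (R : realType) (x : R) : 2 <= x -> 2^-1 <= ln x.
Proof.
move=> x2; apply: le_trans (half_le_ln2 R) _.
by rewrite ler_ln ?posrE //; lra.
Qed.

(** Write [k = d.+1], [l = ln q] and [L = q * l]. After taking logarithms,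
    [(q - 1) / q <= exp (- 1 / q)] reduces the claim to
    [L * k * m < N * (k - L)]. Since [2 * L <= k], the right-hand side is at least
    [4 * L * a * (k / 2) = L * k * (2 * a)], and [m < a + 1 <= 2 * a]. *)
Lemma rare_inequality (R : realType) (q d m N : nat) (a : R) :
  (2 <= q)%N -> 1 <= a -> m%:R < a + 1 -> 2 * q%:R * ln q%:R <= d.+1%:R :> R ->
  4 * ln q%:R * q%:R * a <= N%:R :> R ->
  ((q ^ m) ^ d.+1 * q ^ N * q.-1 ^ (N * d.+1) < q ^ (N * d.+1))%N.
Proof.
move=> q2 a1 ma Ld aN; have q0 : (0 < q)%N by exact: ltnW.
have q2R : 2 <= q%:R :> R by rewrite ler_nat.
have lq := half_le_ln q2R.
rewrite -(ltr_nat R) -expnM -expnD natrM.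
apply: (@le_lt_trans _ _ ((q ^ (m * d.+1 + N))%:R *
    ((q ^ (N * d.+1))%:R * expR (- ((N * d.+1)%:R / q%:R)) : R))).
  by rewrite ler_wpM2l ?ler0n // pred_exp_le.
rewrite mulrCA gtr_pMr ?ltr0n ?expn_gt0 ?q0 //.
rewrite expR_ln_nat // -expRD expR_lt1 subr_lt0 ltr_pdivlMr ?ltr0n //.
rewrite natrD !natrM.
set k : R := d.+1%:R in Ld *; set l := ln q%:R in lq Ld aN *.
set Q : R := q%:R in q2R Ld aN *; set M : R := m%:R in ma *; set n : R := N%:R in aN *.
have k0 : 0 < k by rewrite ltr0n.
have L0 : 0 < l * Q by rewrite mulr_gt0 //; lra.
have h1 : 4 * l * Q * a * (k - l * Q) <= n * (k - l * Q).
  by rewrite ler_wpM2r //; lra.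
have h2 : 2 * l * Q * a * k <= 4 * l * Q * a * (k - l * Q).
  have : 0 <= (l * Q * a) * (2 * (k - 2 * (l * Q))).
    by rewrite mulr_ge0 // ?mulr_ge0 //; lra.
  lra.
have h3 : l * Q * k * M < l * Q * k * (2 * a).
  by rewrite ltr_pM2l ?mulr_gt0 //; lra.
lra.
Qed.

(** [((q - 1) / q) ^ N <= exp (- N / q) <= (2 * q * ln q) ^- r]. *)
Lemma few_inequality (R : realType) (q d r N : nat) :
  (2 <= q)%N -> (0 < r)%N -> d%:R < 2 * q%:R * ln q%:R :> R ->
  r%:R * ln (2 * q%:R * ln q%:R) * q%:R <= N%:R :> R ->
  (d ^ r * q.-1 ^ N < q ^ N)%N.
Proof.
move=> q2 r0 dL LN; have q0 : (0 < q)%N by exact: ltnW.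
have q0R : 0 < q%:R :> R by rewrite ltr0n.
have L0 : 0 < 2 * q%:R * ln q%:R :> R by exact: le_lt_trans dL.
rewrite -(ltr_nat R) natrM.
apply: (@le_lt_trans _ _ ((d ^ r)%:R * ((q ^ N)%:R * expR (- (N%:R / q%:R)) : R))).
  by rewrite ler_wpM2l ?ler0n // pred_exp_le.
rewrite mulrCA gtr_pMr ?ltr0n ?expn_gt0 ?q0 //.
rewrite expRN -ltr_pdivlMr ?invr_gt0 ?expR_gt0 // invrK mul1r.
apply: (@lt_le_trans _ _ ((2 * q%:R * ln q%:R) ^+ r)).
  by rewrite natrX ltrXn2r ?nnegrE ?ler0n ?ltW // -lt0n.
rewrite -[X in X ^+ _]lnK ?posrE // -expRM_natl ler_expR ler_pdivlMr //.
Qed.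

(** The real number whose ceiling is [part_size R r q i]. *)
Definition part_bound (R : realType) (r q i : nat) : R :=
  (r%:R - 1) * ln (2 * q%:R * ln q%:R) * (4 * ln q%:R) ^+ (r - i)
  * q%:R ^+ (r + 1 - i).

Lemma part_bound_ge1 (R : realType) (r q i : nat) :
  (3 <= r)%N -> (2 <= q)%N -> (i <= r)%N -> 1 <= part_bound R r q i.
Proof.
move=> r3 q2 ir.
have q2R : 2 <= q%:R :> R by rewrite ler_nat.
have r3R : 3 <= r%:R :> R by rewrite ler_nat.
have lq := half_le_ln q2R.
have l1 : 2^-1 <= ln (2 * q%:R * ln q%:R) :> R.
  by apply: half_le_ln; nra.
rewrite /part_bound -[leLHS]mulr1 ler_pM // ?exprn_ege1 //; [|lra].
by rewrite -[leLHS]mulr1 ler_pM // ?exprn_ege1 //; [nra|lra].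
Qed.

(** The ratio of consecutive sizes is the one that [rare_inequality] asks for in its
    lower bound on [N]. *)
Lemma part_bound_rec (R : realType) (r q i : nat) :
  (i < r)%N -> part_bound R r q i = 4 * ln q%:R * q%:R * part_bound R r q i.+1.
Proof.
move=> ir; rewrite /part_bound addn1 subSS subSn 1?ltnW // -(subnSK ir) !exprS.
ring.
Qed.

Lemma absz_ceil_itv (R : realType) (x : R) :
  0 <= x -> x <= (`|Num.ceil x|%N)%:R < x + 1.
Proof.
move=> x0; have c0 : 0 <= Num.ceil x by rewrite ceil_ge0; lra.
rewrite natr_absz ger0_norm // ceil_ge /= -ltrBlDr.
by have := ceilB1_lt x; rewrite intrB.
Qed.

Lemma part_size_itv (R : realType) (r q i : nat) :
  (3 <= r)%N -> (2 <= q)%N -> (i <= r)%N ->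
  part_bound R r q i <= (part_size R r q i)%:R < part_bound R r q i + 1.
Proof.
move=> r3 q2 ir; have a1 := part_bound_ge1 R r3 q2 ir.
by apply: absz_ceil_itv; lra.
Qed.

(** Both conditions of [mcycle_solvable] hold for the largest integer [d] that is
    strictly below [2 * q * ln q]: being below it serves the last part, and
    [d.+1] not being below it serves the others. *)
Lemma mcycle_part_size_solvable (R : realType) (r q : nat) :
  (3 <= r)%N -> (2 <= q)%N ->
  solvable (mcycle (fun i : 'I_r => part_size R r q i.+1)) q.
Proof.
case: r => // r r2 q2; have q0 : (0 < q)%N by exact: ltnW.
have q2R : 2 <= q%:R :> R by rewrite ler_nat.
have lq := half_le_ln q2R.
pose L : R := 2 * q%:R * ln q%:R.
have L0 : 0 < L by rewrite /L mulr_gt0 //; lra.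
have [d dL Ld] : exists2 d, d%:R < L & L <= d.+1%:R.
  have /andP[Lc cL] := absz_ceil_itv (ltW L0).
  have c0 : (0 < `|Num.ceil L|)%N by rewrite -(ltr_nat R); exact: lt_le_trans Lc.
  exists (`|Num.ceil L|%N).-1; last by rewrite prednK.
  by rewrite -(ltrD2r 1) natr1 prednK.
apply: (@mcycle_solvable _ _ _ d) => //.
  move=> i imax; have ir : (i < r)%N.
    by rewrite ltn_neqAle -ltnS ltn_ord andbT.
  rewrite /= modn_small ?ltnS //.
  have /andP[_ ma] := @part_size_itv R r.+1 q i.+2 r2 q2 ir.
  have /andP[aN _] := @part_size_itv R r.+1 q i.+1 r2 q2 (ltn_ord i).
  have a1 := @part_bound_ge1 R r.+1 q i.+2 r2 q2 ir.
  by apply: (rare_inequality q2 a1 ma Ld); rewrite -part_bound_rec.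
apply: (few_inequality q2 _ dL) => //; first exact: (@ltnW 1).
have /andP[aN _] := @part_size_itv R r.+1 q r.+1 r2 q2 (leqnn _).
apply: le_trans aN; rewrite /part_bound subnn addn1 subSnn expr0 expr1 mulr1.
by rewrite -[r.+1%:R]natr1 addrK.
Qed.

(** The first part is the largest, so it alone has to fit in [n] vertices. *)
Lemma leq_HG_balanced (R : realType) (r q n : nat) :
  (3 <= r)%N -> (2 <= q)%N -> part_bound R r q 1 <= n%:R ->
  (q <= HG (mcycle (fun _ : 'I_r => n)))%N.
Proof.
move=> r3 q2 an; apply: leq_HG; first exact: mcycle_irreflexive (ltnW r3).
  exact: ltnW.
have := @mcycle_part_size_solvable R r q r3 q2.
case: q q2 an => // q q2 an; apply: mcycle_solvable_mono => i.
have q2R : 2 <= q.+1%:R :> R by rewrite ler_nat.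
have lq := half_le_ln q2R.
have mono k : (k.+1 < r)%N -> part_bound R r q.+1 k.+2 <= part_bound R r q.+1 k.+1.
  move=> kr; rewrite [leRHS]part_bound_rec // ler_peMl //; last by nra.
  by have := part_bound_ge1 R r3 q2 kr; lra.
have le1 k : (k < r)%N -> part_bound R r q.+1 k.+1 <= n%:R.
  elim: k => // k IHk kr; exact: le_trans (mono k kr) (IHk (ltnW kr)).
rewrite /part_size -/(part_bound R r q.+1 i.+1) -(ler_nat int) !natz gez0_abs.
  by rewrite ceil_le_int; exact: le1.
by rewrite ceil_ge0; have := @part_bound_ge1 R r q.+1 i.+1 r3 q2 (ltn_ord i); lra.
Qed.

(** * Parts of equal size *)

(** Here [2 * q * ln q <= q ^ 3] bounds the outer logarithm by [3 * ln q], and then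
    every [ln q] is replaced by [ln n]. *)
Lemma part_bound1_le (R : realType) (r q n : nat) :
  (0 < r)%N -> (2 <= q <= n)%N ->
  part_bound R r q 1 <=
    3 * (r%:R - 1) * 4 ^+ r.-1 * ln n%:R ^+ r * q%:R ^+ r.
Proof.
case: r => // r _ /andP[q2 qn]; have q0 : (0 < q)%N by exact: ltnW.
have q2R : 2 <= q%:R :> R by rewrite ler_nat.
have lq := half_le_ln q2R.
have lqn : ln q%:R <= ln n%:R :> R.
  by rewrite ler_ln ?ler_nat // posrE ltr0n // (leq_trans q0).
have qL : ln q%:R < q%:R :> R by apply: ln_sublinear; lra.
have lL : ln (2 * q%:R * ln q%:R) <= 3 * ln n%:R :> R.
  apply: (@le_trans _ _ (ln (q%:R ^+ 3))).
    rewrite ler_ln ?posrE ?exprn_gt0 ?mulr_gt0 ?ltr0n //; last by lra.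
    by rewrite !exprS expr0 mulr1 mulrA; apply: ler_pM; [lra|lra|nra|lra].
  by rewrite lnXn ?ltr0n // mulr_natl lerMn2r.
rewrite /part_bound subn1 addn1 subn1 /= -[r.+1%:R]natr1 addrK.
rewrite [leRHS](_ : _ = r%:R * (3 * ln n%:R) * (4 * ln n%:R) ^+ r * q%:R ^+ r.+1);
  last by rewrite exprMn exprS; ring.
rewrite ler_wpM2r ?exprn_ge0 //; apply: ler_pM.
- by rewrite mulr_ge0 // ln_ge0 //; nra.
- by rewrite exprn_ge0 //; lra.
- by rewrite ler_wpM2l.
- by apply: lerXn2r; rewrite ?nnegrE; lra.
Qed.

Lemma near_ln_ge (R : realType) (M : R) :
  \forall n \near \oo%classic, M <= ln n%:R.
Proof.
near=> n.
have en : expR M <= n%:R by near: n; exact: nbhs_infty_ger.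
by rewrite -(expRK M) ler_ln ?posrE ?expR_gt0 // (lt_le_trans _ en) ?expR_gt0.
Unshelve. all: by end_near. Qed.

(** Chosen so that [n ^ loglog_exponent n = (ln n) ^ 2] once [1 < n]: the square
    leaves room, in the power [r], for the factor [(ln n) ^ r] in [part_bound1_le]
    and for a constant. *)
Definition loglog_exponent (R : realType) (n : nat) : R := 2 * (ln (ln n%:R) / ln n%:R).

(** [ln y = 2 * ln (sqrt y)], and [ln] grows less than linearly. *)
Lemma ln_div_le (R : realType) (y : R) : 1 <= y -> ln y / y <= 2 / Num.sqrt y.
Proof.
move=> y1; have y0 : 0 < y by lra.
have s0 : 0 < Num.sqrt y by rewrite sqrtr_gt0.
rewrite -{1 2}[y](sqr_sqrtr (ltW y0)) lnXn // ler_pdivrMr ?exprn_gt0 //.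
by rewrite expr2 mulrA divfK ?gt_eqF // mulr_natl lerMn2r ltW ?ln_sublinear.
Qed.

Lemma loglog_exponent_cvg0 (R : realType) :
  (@loglog_exponent R n @[n --> \oo] --> 0)%classic.
Proof.
apply/cvgrPdist_le => e e0; near=> n.
have : Num.max 1 ((4 / e) ^+ 2) <= ln n%:R :> R by near: n; exact: near_ln_ge.
rewrite ge_max /loglog_exponent => /andP[]; move: (ln n%:R) => y y1 ye.
rewrite sub0r normrN ger0_norm; last first.
  by rewrite mulr_ge0 // divr_ge0 ?ln_ge0 //; lra.
have s0 : 0 < Num.sqrt y by rewrite sqrtr_gt0; lra.
have : 4 / e <= Num.sqrt y.
  have e4 : 0 <= 4 / e by rewrite divr_ge0 // ltW.
  by rewrite -(ger0_norm e4) -sqrtr_sqr ler_wsqrtr.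
rewrite ler_pdivrMr // => es.
have : 2 / Num.sqrt y <= e / 2 by rewrite ler_pdivrMr //; lra.
by have := ln_div_le y1; lra.
Unshelve. all: by end_near. Qed.

Lemma powR_loglog_exponent (R : realType) (n r : nat) : 1 <= ln n%:R :> R ->
  n%:R `^ (r%:R^-1 - loglog_exponent R n) = n%:R `^ r%:R^-1 / ln n%:R ^+ 2.
Proof.
move=> y1; have n0 : 0 < n%:R :> R.
  by rewrite ltNge; apply/negP => /le_trans/(_ ler01)/ln_le0; lra.
rewrite powRB; last by rewrite (gt_eqF n0) implybT.
congr (_ / _); rewrite {1}/powR (gt_eqF n0) /loglog_exponent -mulrA divfK;
  last by rewrite gt_eqF //; lra.
by rewrite expRM_natl lnK // posrE; lra.
Qed.

(** Put [t = n ^ (1 / r) / (ln n) ^ 2] and take [truncn t] colors. The first part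
    then needs at most [C * (ln n) ^ r * t ^ r = C * n / (ln n) ^ r <= n] vertices,
    with [C] the left-hand side of the last hypothesis. Rounding down costs at most
    a factor 2; when [t < 2], a single color already suffices. *)
Lemma HG_balanced_ge (R : realType) (r n : nat) : (3 <= r)%N ->
  1 <= ln n%:R :> R ->
  3 * (r%:R - 1) * 4 ^+ r.-1 <= ln n%:R :> R ->
  n%:R `^ (r%:R^-1 - loglog_exponent R n) <= 2 * (HG (mcycle (fun _ : 'I_r => n)))%:R.
Proof.
move=> r3 y1 Cy; rewrite powR_loglog_exponent //.
have n1 : 1 <= n%:R :> R.
  by rewrite leNgt; apply/negP => /ltW/ln_le0; lra.
have n0 : 0 < n%:R :> R by lra.
set y := ln n%:R in y1 Cy *; set t := _ / _.
have y2 : 0 < y ^+ 2 by rewrite exprn_gt0; lra.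
have t0 : 0 <= t by rewrite divr_ge0 ?powR_ge0 // ltW.
have r0 : r%:R != 0 :> R by rewrite pnatr_eq0 -lt0n (leq_trans _ r3).
have tr : t ^+ r * y ^+ r * y ^+ r = n%:R.
  rewrite -mulrA -exprD addnn -mul2n exprM -exprMn divfK ?gt_eqF //.
  by rewrite -powR_mulrn ?powR_ge0 // -powRrM mulVf // powRr1 // ltW.
have tn : t <= n%:R.
  apply: (@le_trans _ _ (n%:R `^ r%:R^-1)).
    by rewrite ler_pdivrMr // ler_peMr ?powR_ge0 // exprn_ege1.
  by rewrite ler1_powR // invf_le1 ?ltr0n ?ler1n // (leq_trans _ r3).
have [t2|t2] := ltP t 2.
  have HG1 : (1 <= HG (mcycle (fun _ : 'I_r => n)))%N.
    apply: leq_HG => //; first exact: mcycle_irreflexive (ltnW r3).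
    apply: solvable1; apply/card_gt0P.
    have r0' : (0 < r)%N by exact: leq_trans r3.
    have n0' : (0 < n)%N by rewrite -(ltr0n R).
    by exists (Tagged (fun=> 'I_n) (i := Ordinal r0') (Ordinal n0')).
  have : 1 <= (HG (mcycle (fun _ : 'I_r => n)))%:R :> R by rewrite ler1n.
  lra.
pose q := Num.truncn t.
have /andP[qt tq] := truncn_itv t0; rewrite -/q in qt tq.
have q2 : (2 <= q)%N by rewrite /q truncn_ge_nat.
have q2R : 2 <= q%:R :> R by rewrite ler_nat.
suff : (q <= HG (mcycle (fun _ : 'I_r => n)))%N.
  by rewrite -(ler_nat R); rewrite -natr1 in tq; lra.
apply: (leq_HG_balanced (R := R)) => //.
have qn : (q <= n)%N by rewrite -(ler_nat R); exact: le_trans tn.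
have q2n : (2 <= q <= n)%N by rewrite q2.
apply: le_trans (part_bound1_le R (leq_trans _ r3) q2n) _ => //.
rewrite -/y -tr; have r1R : 1 <= r%:R :> R by rewrite ler1n (leq_trans _ r3).
have C0 : 0 <= 3 * (r%:R - 1) * 4 ^+ r.-1 :> R.
  by rewrite mulr_ge0 ?exprn_ge0 //; lra.
have yr : y <= y ^+ r by apply: ler_eXnr => //; exact: leq_trans r3.
have yr0 : 0 <= y ^+ r by rewrite exprn_ge0 //; lra.
rewrite (_ : _ * y ^+ r * y ^+ r = y ^+ r * y ^+ r * t ^+ r); last by ring.
apply: ler_pM; [exact: mulr_ge0|exact: exprn_ge0| |].
  by rewrite ler_wpM2r //; exact: le_trans yr.
by apply: lerXn2r; rewrite ?nnegrE.
Qed.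

Local Open Scope classical_set_scope.
Local Open Scope ring_scope.

(* The parts V_1, ..., V_r are indexed by 'I_r, hence the shift i.+1. *)
Theorem theorem1p3 (R : realType) (r : nat) (r_ge3 : (3 <= r)%N) :
  (forall q : nat, (2 <= q)%N ->
     (q <= HG (mcycle (fun i : 'I_r => part_size R r q i.+1)))%N) /\
  (exists2 eps : nat -> R, eps @ \oo --> (0 : R) &
     (fun n : nat => (HG (mcycle (fun _ : 'I_r => n)))%:R : R^o)
       =Omega_\oo (fun n : nat => n%:R `^ (r%:R^-1 - eps n) : R^o)).
Proof.
split=> [q q2|].
  apply: leq_HG; [exact: mcycle_irreflexive (ltnW r_ge3)|exact: ltnW|].
  exact: mcycle_part_size_solvable.
exists (@loglog_exponent R); first exact: loglog_exponent_cvg0.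
rewrite eqOmegaE eqOmegaO; apply/eqO_exP; exists 2 => //; near=> n.
rewrite /= !ger0_norm ?powR_ge0 //; apply: HG_balanced_ge => //.
  by near: n; exact: near_ln_ge.
by near: n; exact: near_ln_ge.
Unshelve. all: by end_near. Qed.
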